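(* For every partition $\lambda$ and every $n\ge2$, $$\mathbb{F}_\lambda(\kappa_1,\dots,\kappa_{n-1},s_n\xi_n\mid\Xi,\mathsf{S})=\mathbb{F}_\lambda(\kappa_1,\dots,\kappa_{n-1}\mid\Xi,\mathsf{S}).$$
   Context: Fix a generic parameter $q$, and write $(x;q)_n:=\prod_{i=1}^n(1-xq^{i-1})$, $(x;q)_0:=1$. A partition is a weakly decreasing sequence $\lambda=(\lambda_1\ge\lambda_2\ge\dots\ge0)$ of nonnegative integers with finitely many nonzero entries; $\varnothing$ is the zero partition, $l(\lambda)$ is the number of nonzero parts and $\lambda'$ is the conjugate partition, so the number of parts of $\lambda'$ equal to $j$ is $m_j(\lambda')=\lambda_j-\lambda_{j+1}$. Let $\Xi=(\xi_0,\xi_1,\dots)$ and $\mathsf{S}=(s_0,s_1,\dots)$ be sequences of generic parameters, with fixed square roots $\sqrt{\xi_i},\sqrt{s_i}$. For $k\ge0$ put $s_i^{(k)}:=\sqrt{s_{i+k}\xi_{i+k}s_i/\xi_i}$ (formed from the fixed roots) and $\tau^k_{\Xi}\mathsf{S}:=(s^{(k)}_0,s^{(k)}_1,\dots)$. Vertex weights: for $i,j,k,l\in\mathbb{Z}_{\ge0}$ (labels of the bottom, left, top, right edge), $$W_{t,s}(i,j;k,l):=\mathbf{1}_{i+j=k+l}\,\mathbf{1}_{i\ge l}\,(s^2/t^2)^{l}\frac{(s^2/t^2;q)_{i-l}(t^2;q)_l}{(s^2;q)_i}\frac{(q;q)_i}{(q;q)_{i-l}(q;q)_l},$$ which depends only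 on $t^2,s^2$. Partition function: for $a_1,\dots,a_n\in\mathbb{Z}_{\ge0}$ and $L>l(\lambda),l(\mu)$, $$ZW^{(a_1,\dots,a_n)}_{\lambda/\mu}(\kappa_1,\dots,\kappa_n\mid\Xi,\mathsf{S}):=\sum\prod_{r=1}^n\prod_{c=1}^L W_{t_{r,c},\,s^{(r)}_c}(v_{r,c},h_{r,c-1};v_{r-1,c},h_{r,c}),\qquad t_{r,c}^2=\frac{\xi_{r+c}s_{r+c}}{\kappa_r},$$ where the sum is over all nonnegative integers $v_{r,c}$ ($0\le r\le n$, $1\le c\le L$) and $h_{r,c}$ ($1\le r\le n$, $0\le c\le L$) subject to $v_{0,c}=m_c(\lambda')$, $v_{n,c}=m_c(\mu')$, $h_{r,0}=a_r$, $h_{r,L}=0$; the result does not depend on $L$. Set $$\mathbb{F}^{\mathsf s}_{\lambda/\mu}(\kappa_1,\dots,\kappa_n\mid\Xi,\mathsf{S}):=\sum_{a_1+\dots+a_n=\lambda_1-\mu_1}\Bigl(\prod_{i=1}^n(\kappa_is_0/\xi_0)^{a_i}\frac{(\kappa_i^{-1}s_i\xi_i;q)_{a_i}}{(q;q)_{a_i}}\Bigr)ZW^{(a_1,\dots,a_n)}_{\lambda/\mu}(\kappa_1,\dots,\kappa_n\mid\Xi,\mathsf{S}),$$ $$\mathbb{F}_{\lambda/\mu}(\kappa_1,\dots,\kappa_n\mid\Xi,\mathsf{S}):=\frac{(-\tau^n_\Xi\mathsf{S})^{\mu}}{(-\mathsf{S})^{\lambda}}\frac{\mathsf{c}_{\tau^n_\Xi\mathsf{S}}(\mu)}{\mathsf{c}_{\mathsf{S}}(\lambda)}\,\mathbb{F}^{\mathsf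 s}_{\lambda/\mu}(\kappa_1,\dots,\kappa_n\mid\Xi,\mathsf{S}),$$ where $\mathsf{c}_{\mathsf{S}}(\lambda):=\prod_{i\ge1}\frac{(s_i^2;q)_{\lambda_i-\lambda_{i+1}}}{(q;q)_{\lambda_i-\lambda_{i+1}}}$ and $(-\mathsf{S})^\lambda:=\prod_{i\ge1}(-s_{i-1})^{\lambda_i}$ (and likewise with $\mathsf S$ replaced by $\tau^n_\Xi\mathsf S$). These functions are polynomials in $\kappa_1,\dots,\kappa_n$. Finally $\mathbb{F}_\lambda:=\mathbb{F}_{\lambda/\varnothing}$. *)

(* Defs.v *)
From mathcomp Require Import all_boot all_order all_algebra.

Set Implicit Arguments.
Unset Strict Implicit.
Unset Printing Implicit Defensive.

Import GRing.Theory.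
Local Open Scope ring_scope.

(* A partition is stored as the weakly decreasing list of its nonzero parts,  *)
(* so l(lam) = size lam and the zero partition is [::].                       *)
Definition is_partition (lam : seq nat) : bool :=
  sorted geq lam && (0%N \notin lam).

(* lam_i, with 1-based i; equal to 0 for i > size lam.                        *)
Definition part (lam : seq nat) (i : nat) : nat := nth 0%N lam i.-1.

Definition conj_part (lam : seq nat) : seq nat :=
  [seq count (fun x => j < x)%N lam | j <- iota 0 (part lam 1)].

(* m_j(lam), the number of parts equal to j (meant for j >= 1).               *)
Definition mult (j : nat) (lam : seq nat) : nat := count_mem j lam.

Lemma mult_conj (lam : seq nat) (j : nat) :
  is_partition lam -> (0 < j)%N ->
  mult j (conj_part lam) = (part lam j - part lam j.+1)%N.
Proof.
case: j => // j /andP[slam _] _; rewrite /mult /part /= /conj_part.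
have tr : transitive geq by move=> a b c ba cb; apply: leq_trans cb ba.
have le (l : seq nat) (a b : nat) : sorted geq l -> (a <= b)%N ->
    (nth 0 l b <= nth 0 l a)%N.
  move=> sl ab; case: (ltnP b (size l)) => bs; last by rewrite nth_default.
  by apply: (sorted_leq_nth tr (fun x => leqnn x) 0%N sl) => //;
     rewrite inE; apply: leq_ltn_trans ab bs.
have cntE (l : seq nat) k i : sorted geq l ->
    (k < count (fun x => i < x) l)%N = (i < nth 0 l k)%N.
  elim: l k => [|x l IH] k sl /=; first by rewrite nth_nil.
  have sl' := path_sorted sl.
  case: (ltnP i x) => xi /=; first by case: k => [|k]; rewrite //= ltnS IH.
  have lx m : (nth 0 l m <= x)%N by apply: (le _ 0%N m.+1 sl).
  have -> : count (fun y => i < y)%N l = 0%N.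
    apply/eqP; rewrite -leqn0 leqNgt -has_count -all_predC.
    by apply/(all_nthP 0%N) => m _; rewrite /= -leqNgt (leq_trans (lx m)).
  rewrite ltn0; case: k => [|k] /=; first by rewrite ltnNge xi.
  by apply/esym/negbTE; rewrite -leqNgt (leq_trans (lx k)).
have mono : (nth 0 lam j.+1 <= nth 0 lam j <= nth 0 lam 0)%N by rewrite !le.
rewrite count_map -[part lam 1]/(nth 0%N lam 0).
rewrite (eq_count (a2 := fun i => (nth 0 lam j.+1 <= i < nth 0 lam j)%N)); last first.
  move=> i; have c1 := cntE lam j i slam; have c2 := cntE lam j.+1 i slam.
  by rewrite -c1 [(_ <= i)%N]leqNgt -c2 -leqNgt /= eqn_leq.
case/andP: mono.
move: (nth 0%N lam j.+1) (nth 0%N lam j) (nth 0%N lam 0) => A B C AB BC.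
rewrite -size_filter.
suff -> : [seq i <- iota 0 C | (A <= i < B)%N] = iota A (B - A)
    by rewrite size_iota.
  have -> : C = (A + (B - A) + (C - B))%N by rewrite subnKC // subnKC.
  rewrite !iotaD !filter_cat add0n.
  rewrite (eq_in_filter (a2 := pred0)) => [|i]; last first.
    by rewrite mem_iota /= add0n => iA; rewrite leqNgt iA.
  rewrite filter_pred0 /= (eq_in_filter (a2 := predT)) => [|i]; last first.
    by rewrite mem_iota subnKC.
  rewrite filter_predT (eq_in_filter (a2 := pred0)) => [|i]; last first.
    by rewrite mem_iota subnKC // => /andP[Bi _]; rewrite [(i < B)%N]ltnNge Bi andbF.
  by rewrite filter_pred0 cats0.
Qed.

Section Functions.

(* xi_i = rxi i ^+ 2 and s_i = rs i ^+ 2: a sequence of parameters together   *)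
(* with its fixed square roots is given by the sequence of the roots.         *)
Variables (F : fieldType) (q : F).

Definition qpoch (x : F) (n : nat) : F := \prod_(i < n) (1 - x * q ^+ i).

Definition sq (r : nat -> F) (i : nat) : F := r i ^+ 2.

Definition tau (k : nat) (rxi rs : nat -> F) (i : nat) : F :=
  rs (i + k)%N * rxi (i + k)%N * rs i / rxi i.

(* Genericity enters only through the non-vanishing of the denominators of    *)
(* the functions below (those involving kappa excepted).                      *)
Definition generic (rxi rs : nat -> F) : Prop :=
  [/\ forall n, qpoch q n != 0,
      forall i, rxi i != 0,
      forall i, rs i != 0,
      forall i n, (0 < i)%N -> qpoch (sq rs i ^+ 2) n != 0 &
      forall k i n, (0 < i)%N -> qpoch (tau k rxi rs i ^+ 2) n != 0].

(* W_{t,s}(i,j;k,l) as a function of t2 = t^2 and s2 = s^2.                   *)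
Definition vertexW (t2 s2 : F) (i j k l : nat) : F :=
  if (i + j == k + l)%N && (l <= i)%N then
    (s2 / t2) ^+ l * (qpoch (s2 / t2) (i - l) * qpoch t2 l / qpoch s2 i)
    * (qpoch q i / (qpoch q (i - l) * qpoch q l))
  else 0.

Lemma vertexW_neq0 (t2 s2 : F) (i j k l : nat) :
  vertexW t2 s2 i j k l != 0 -> (i + j = k + l)%N /\ (l <= i)%N.
Proof. by rewrite /vertexW; case: andP => [[/eqP]|_]; rewrite ?eqxx. Qed.

(* The row/column indices r, c of the lattice are r.+1, c.+1 for the ordinals *)
(* r : 'I_n, c : 'I_L below; tnth kappa r is kappa_{r+1}. Labels are bounded  *)
(* by lam_1, which loses nothing by config_bounded.                           *)
Definition ZW (L n : nat) (a : 'I_n -> nat) (lam mu : seq nat)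
    (kappa : n.-tuple F) (rxi rs : nat -> F) : F :=
  \sum_(v : 'M['I_(part lam 1).+1]_(n.+1, L) |
        [forall c : 'I_L, (v ord0 c == mult c.+1 (conj_part lam) :> nat)
                       && (v ord_max c == mult c.+1 (conj_part mu) :> nat)])
  \sum_(h : 'M['I_(part lam 1).+1]_(n, L.+1) |
        [forall r : 'I_n, (h r ord0 == a r :> nat)
                       && (h r ord_max == 0%N :> nat)])
  \prod_(r < n) \prod_(c < L)
    vertexW (sq rxi (r.+1 + c.+1) * sq rs (r.+1 + c.+1) / tnth kappa r)
            (tau r.+1 rxi rs c.+1 ^+ 2)
            (v (lift ord0 r) c) (h r (widen_ord (leqnSn L) c))
            (v (widen_ord (leqnSn n) r) c) (h r (lift ord0 c)).

(* ZW is the same for every L > l(lam), l(mu); the smallest one is used.      *)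
Definition bFs (lam mu : seq nat) (n : nat) (kappa : n.-tuple F)
    (rxi rs : nat -> F) : F :=
  \sum_(a : {ffun 'I_n -> 'I_(part lam 1).+1} |
        (\sum_i a i + part mu 1 == part lam 1)%N)
    (\prod_(i < n)
       ((tnth kappa i * sq rs 0 / sq rxi 0) ^+ a i
        * (qpoch ((tnth kappa i)^-1 * sq rs i.+1 * sq rxi i.+1) (a i)
           / qpoch q (a i))))
    * ZW (maxn (size lam) (size mu)).+1 (fun i => a i) lam mu kappa rxi rs.

Definition cfac (s : nat -> F) (lam : seq nat) : F :=
  \prod_(1 <= i < (size lam).+1)
    (qpoch (s i ^+ 2) (part lam i - part lam i.+1)
     / qpoch q (part lam i - part lam i.+1)).

(* (-S)^lam *)
Definition negpow (s : nat -> F) (lam : seq nat) : F :=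
  \prod_(1 <= i < (size lam).+1) (- s i.-1) ^+ part lam i.

Definition bF (lam mu : seq nat) (n : nat) (kappa : n.-tuple F)
    (rxi rs : nat -> F) : F :=
  negpow (tau n rxi rs) mu / negpow (sq rs) lam
  * (cfac (tau n rxi rs) mu / cfac (sq rs) lam)
  * bFs lam mu kappa rxi rs.

End Functions.

Lemma config_bounded (n L : nat) (lam : seq nat) (v h : nat -> nat -> nat) :
  (forall c, (0 < c <= L)%N -> v 0%N c = mult c (conj_part lam)) ->
  (forall r, (0 < r <= n)%N -> h r L = 0%N) ->
  (forall r c, (0 < r <= n)%N -> (0 < c <= L)%N ->
     (v r c + h r c.-1 = v r.-1 c + h r c)%N /\ (h r c <= v r c)%N) ->
  (forall r c, (r <= n)%N -> (0 < c <= L)%N -> (v r c <= part lam 1)%N) /\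
  (forall r c, (0 < r <= n)%N -> (c <= L)%N -> (h r c <= part lam 1)%N).
Proof.
move=> v0 hL vh; pose S r := (\sum_(c < L) v r c.+1)%N.
have S0 : (S 0 <= part lam 1)%N.
  rewrite /S (eq_bigr (fun c : 'I_L => mult c.+1 (conj_part lam))) => [|c _].
    rewrite -[leqRHS](size_iota 0) -(size_map (fun j => count (fun x => j < x)%N lam)).
    rewrite -/(conj_part lam); elim: (conj_part lam) => [|x l IH].
      by rewrite big1.
    rewrite /mult /= big_split /= -add1n leq_add // ?(IH) //.
    case: (ltnP x.-1 L) => xL; last first.
      rewrite big1 // => i _; case: eqP => // xi; move: xL; rewrite xi /=.
      by rewrite leqNgt ltn_ord.
    rewrite (bigD1 (Ordinal xL)) //= big1 ?addn0 ?leq_b1 // => i ne.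
    case: eqP => // xi; case/eqP: ne; apply: val_inj; by rewrite /= xi.
  by rewrite v0 // ltn_ord.
have Sr r : (r < n)%N -> (S r = S r.+1 + h r.+1 0)%N.
  move=> rn; suff H k : (k <= L)%N ->
    (\sum_(c < k) v r c.+1 + h r.+1 k = \sum_(c < k) v r.+1 c.+1 + h r.+1 0)%N.
    by have := H L (leqnn L); rewrite hL // addn0.
  elim: k => [|k IH] kL; first by rewrite !big_ord0.
  rewrite !big_ord_recr /=.
  have [/= E _] := vh r.+1 k.+1 rn kL.
  by rewrite -addnA -E addnCA IH ?(ltnW kL) // addnCA addnA.
have Sb r : (r <= n)%N -> (S r <= part lam 1)%N.
  elim: r => // r IH rn; apply: leq_trans (IH (ltnW rn)).
  by rewrite (Sr r rn) leq_addr.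
have vb r c : (r <= n)%N -> (0 < c <= L)%N -> (v r c <= part lam 1)%N.
  case: c => // c rn /= cL; apply: leq_trans (Sb r rn).
  by rewrite /S (bigD1 (Ordinal cL)) //= leq_addr.
split=> // -[|r] // [|c] rn cL.
  by apply: leq_trans (Sb r (ltnW rn)); rewrite (Sr r rn) leq_addl.
by have [_ /leq_trans] := vh r.+1 c.+1 rn cL; apply; apply: vb.
Qed.

(* Main.v *)
(* At kappa_n = s_n xi_n the factor (kappa_n^-1 s_n xi_n; q)_{a_n} = (1; q)_{a_n}
   kills every term with a_n > 0. The last row of the lattice then has nothing
   on its left edge and nothing on its bottom edges (mu is empty); as a vertex
   weight vanishes when more paths leave to the right than enter from below, the
   whole row is empty, has weight 1, and can be deleted. *)
Require Import Defs.
From mathcomp Require Import all_boot all_order all_algebra.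

Set Implicit Arguments.
Unset Strict Implicit.
Unset Printing Implicit Defensive.

Import GRing.Theory.
Local Open Scope ring_scope.

Lemma lift_max_widen (n : nat) (i : 'I_n) :
  lift ord_max i = widen_ord (leqnSn n) i.
Proof. exact/val_inj/lift_max. Qed.

Lemma lift0_widen (n : nat) (i : 'I_n) :
  lift ord0 (widen_ord (leqnSn n) i) = widen_ord (leqnSn n.+1) (lift ord0 i).
Proof. exact: val_inj. Qed.

Lemma lift0_max (n : nat) : lift ord0 (@ord_max n) = ord_max.
Proof. exact: val_inj. Qed.

Section AppendLast.
Variables (T : Type) (n : nat) (x : T).

(** Inverse to restriction along [widen_ord] on functions with last value [x]. It extends label
    vectors directly, and matrices column by column. *)
Definition ord_rcons (f : 'I_n -> T) (i : 'I_n.+1) : T :=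
  oapp f x (unlift ord_max i).

Lemma ord_rcons_max (f : 'I_n -> T) : ord_rcons f ord_max = x.
Proof. by rewrite /ord_rcons unlift_none. Qed.

Lemma ord_rcons_widen (f : 'I_n -> T) (i : 'I_n) :
  ord_rcons f (widen_ord (leqnSn n) i) = f i.
Proof. by rewrite /ord_rcons -lift_max_widen liftK. Qed.

Lemma ord_rconsK (g : 'I_n.+1 -> T) :
  g ord_max = x -> ord_rcons (fun i => g (widen_ord (leqnSn n) i)) =1 g.
Proof.
move=> gx i; rewrite /ord_rcons; case: unliftP => [j|] -> //=.
by rewrite lift_max_widen.
Qed.

End AppendLast.

Lemma tnth_rcons_widen (T : Type) (n : nat) (t : n.-tuple T) (x : T) (i : 'I_n) :
  tnth (rcons_tuple t x) (widen_ord (leqnSn n) i) = tnth t i.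
Proof.
rewrite (tnth_nth x) [RHS](tnth_nth x) /= nth_rcons size_tuple.
by rewrite ltn_ord.
Qed.

Lemma tnth_rcons_max (T : Type) (n : nat) (t : n.-tuple T) (x : T) :
  tnth (rcons_tuple t x) ord_max = x.
Proof. by rewrite (tnth_nth x) /= nth_rcons size_tuple ltnn eqxx. Qed.

Section SumLastFixed.
Variables (V : nmodType) (T : finType) (x : T) (n : nat).

(** Terms with another last entry vanish; on the others, dropping and restoring the last entry are
    mutually inverse. *)
Lemma sum_ffun_last (P : pred {ffun 'I_n.+1 -> T})
    (G : {ffun 'I_n.+1 -> T} -> V) :
  (forall a, P a -> G a != 0 -> a ord_max = x) ->
  \sum_(a | P a) G a =
  \sum_(b : {ffun 'I_n -> T} | P [ffun i => ord_rcons x b i])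
     G [ffun i => ord_rcons x b i].
Proof.
move=> Gx.
transitivity (\sum_(a | P a && (a ord_max == x)) G a).
  rewrite big_mkcondr; apply: eq_bigr => a Pa.
  by case: eqP => // ax; apply/eqP/negPn/negP => /(Gx a Pa).
rewrite (reindex_onto (fun b : {ffun 'I_n -> T} => [ffun i => ord_rcons x b i])
  (fun a => [ffun i => a (widen_ord (leqnSn n) i)])) /=.
  apply: eq_bigl => b; rewrite ffunE ord_rcons_max eqxx andbT.
  suff -> : [ffun i => [ffun j => ord_rcons x b j] (widen_ord (leqnSn n) i)] = b.
    by rewrite eqxx andbT.
  by apply/ffunP => i; rewrite !ffunE ord_rcons_widen.
move=> a /andP[_ /eqP ax]; apply/ffunP => i; rewrite ffunE -[RHS](ord_rconsK ax).
by rewrite /ord_rcons; case: (unlift _ _) => //= j; rewrite ffunE.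
Qed.

(** The same bijection for rows. The last row may be fixed by [P] alone, as for vertical labels, or
    with the help of [G A != 0], as for horizontal ones. *)
Lemma sum_mx_last (m : nat) (P : pred 'M[T]_(n.+1, m))
    (G : 'M[T]_(n.+1, m) -> V) :
  (forall A, P A -> G A != 0 -> forall c, A ord_max c = x) ->
  \sum_(A | P A) G A =
  \sum_(B : 'M[T]_(n, m) | P (\matrix_(i, c) ord_rcons x (B^~ c) i))
     G (\matrix_(i, c) ord_rcons x (B^~ c) i).
Proof.
move=> Gx.
transitivity (\sum_(A | P A && [forall c, A ord_max c == x]) G A).
  rewrite big_mkcondr; apply: eq_bigr => A PA.
  case: ifP => // /negbT/negP Ax; apply/eqP/negPn/negP => /(Gx A PA) E.
  by apply: Ax; apply/forallP => c; rewrite E.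
rewrite (reindex_onto (fun B : 'M[T]_(n, m) => \matrix_(i, c) ord_rcons x (B^~ c) i)
  (fun A => \matrix_(i, c) A (widen_ord (leqnSn n) i) c)) /=.
  apply: eq_bigl => B.
  have -> : [forall c, (\matrix_(i, c) ord_rcons x (B^~ c) i) ord_max c == x].
    by apply/forallP => c; rewrite mxE ord_rcons_max.
  rewrite andbT; set C := (X in X == B); suff -> : C = B by rewrite eqxx andbT.
  by apply/matrixP => i c; rewrite !mxE ord_rcons_widen.
move=> A /andP[_ /forallP Ax]; apply/matrixP => i c; rewrite mxE.
rewrite -[RHS](ord_rconsK (g := A^~ c) (eqP (Ax c))).
by rewrite /ord_rcons; case: (unlift _ _) => //= j; rewrite mxE.
Qed.

End SumLastFixed.

Section Stability.
Variables (F : fieldType) (q : F).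

Lemma qpoch0 (x : F) : qpoch q x 0 = 1.
Proof. by rewrite /qpoch big_ord0. Qed.

(** For n > 0 the first factor of (1; q)_n is 1 - q^0 = 0. *)
Lemma qpoch1_neq0 (n : nat) : qpoch q 1 n != 0 -> n = 0%N.
Proof.
by case: n => // n; rewrite /qpoch big_ord_recl expr0 mulr1 subrr mul0r eqxx.
Qed.

Lemma vertexW_empty (t2 s2 : F) : vertexW q t2 s2 0 0 0 0 = 1.
Proof. by rewrite /vertexW /= !qpoch0 expr0 !(mulr1, invr1). Qed.

(** A nonzero weight needs l <= i = 0, so each right label vanishes at its own vertex, without
    induction along the row. Conservation then clears the top labels. *)
Lemma row_neq0_empty (L : nat) (t2 s2 : 'I_L -> F) (k : 'I_L -> nat)
    (h : 'I_L.+1 -> nat) :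
  h ord0 = 0%N ->
  \prod_(c < L) vertexW q (t2 c) (s2 c) 0 (h (widen_ord (leqnSn L) c)) (k c)
                        (h (lift ord0 c)) != 0 ->
  (forall c, h c = 0%N) /\ (forall c, k c = 0%N).
Proof.
move=> h0 /prodf_neq0 nz.
have hE c : h c = 0%N.
  case: (unliftP ord0 c) => [j|] -> //.
  by have [_] := vertexW_neq0 (nz j isT); rewrite leqn0 => /eqP.
split=> // c; have [+ _] := vertexW_neq0 (nz c isT).
by rewrite !hE !addn0 => <-.
Qed.

Lemma eq_ZW (L n : nat) (a b : 'I_n -> nat) (lam mu : seq nat)
    (kappa : n.-tuple F) (rxi rs : nat -> F) :
  a =1 b -> ZW q L a lam mu kappa rxi rs = ZW q L b lam mu kappa rxi rs.
Proof.
move=> ab; apply: eq_bigr => v _; apply: eq_bigl => h.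
by apply: eq_forallb => r; rewrite ab.
Qed.

(** Vertical row n is the bottom boundary of the short lattice, prescribed to be empty, but not of
    the long one. The sums match because a nonzero weight forces it to be empty there too. *)
Lemma ZW_rcons_empty (L n : nat) (a : 'I_n.+1 -> nat) (lam : seq nat)
    (kappa : n.-tuple F) (x : F) (rxi rs : nat -> F) :
  a ord_max = 0%N ->
  ZW q L a lam [::] (rcons_tuple kappa x) rxi rs =
  ZW q L (fun i => a (widen_ord (leqnSn n) i)) lam [::] kappa rxi rs.
Proof.
move=> a0; rewrite /ZW.
(* [widen_ord _ ord_max] indexes vertical row n, the top edges of the last lattice row. *)
have last_row (v : 'M['I_(part lam 1).+1]_(n.+2, L))
    (h : 'M['I_(part lam 1).+1]_(n.+1, L.+1)) :
  [forall c, (v ord0 c == mult c.+1 (conj_part lam) :> nat)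
          && (v ord_max c == mult c.+1 (conj_part [::]) :> nat)] ->
  [forall r, (h r ord0 == a r :> nat) && (h r ord_max == 0%N :> nat)] ->
  \prod_(r < n.+1) \prod_(c < L)
    vertexW q (sq rxi (r.+1 + c.+1) * sq rs (r.+1 + c.+1)
                 / tnth (rcons_tuple kappa x) r)
            (tau r.+1 rxi rs c.+1 ^+ 2)
            (v (lift ord0 r) c) (h r (widen_ord (leqnSn L) c))
            (v (widen_ord (leqnSn n.+1) r) c) (h r (lift ord0 c)) != 0 ->
  (forall c, h ord_max c = ord0) /\ (forall c, v (widen_ord (leqnSn n.+1) ord_max) c = ord0).
  move=> /forallP Pv /forallP Ph; rewrite big_ord_recr /= mulf_eq0 negb_or.
  case/andP=> _; under eq_bigr => c _ do
    rewrite lift0_max (eqP (proj2 (andP (Pv c)))).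
  move=> nz; have h0 : h ord_max ord0 = 0%N :> nat.
    by have /andP[/eqP -> _] := Ph ord_max.
  have [hE kE] := row_neq0_empty (h := fun c => h ord_max c)
    (k := fun c => v (widen_ord (leqnSn n.+1) ord_max) c) h0 nz.
  by split=> c; apply: val_inj; rewrite /= ?hE ?kE.
(* The bottom row of [v] is fixed by the boundary condition: [conj_part [::]] is empty, so its
   multiplicities are 0. *)
rewrite (sum_mx_last (x := ord0)); last first.
  move=> v /forallP Pv _ c; apply: val_inj.
  by have /andP[_ /eqP E] := Pv c; exact: E.
have PE (v : 'M['I_(part lam 1).+1]_(n.+1, L)) :
  [forall c, ((\matrix_(i, c) ord_rcons ord0 (v^~ c) i) ord0 c
                 == mult c.+1 (conj_part lam) :> nat)
          && ((\matrix_(i, c) ord_rcons ord0 (v^~ c) i) ord_max c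
                 == mult c.+1 (conj_part [::]) :> nat)]
  = [forall c, v ord0 c == mult c.+1 (conj_part lam) :> nat].
  apply: eq_forallb => c; rewrite !mxE ord_rcons_max andbT.
  by have <- : widen_ord (leqnSn n.+1) ord0 = ord0 by [exact: val_inj];
     rewrite ord_rcons_widen.
(* Splitting off the bottom condition of the short lattice turns it into an [if] on the summand, so
   that both sides can be compared for each [v]. *)
have P'E (v : 'M['I_(part lam 1).+1]_(n.+1, L)) :
  [forall c, (v ord0 c == mult c.+1 (conj_part lam) :> nat)
          && (v ord_max c == mult c.+1 (conj_part [::]) :> nat)]
  = [forall c, v ord0 c == mult c.+1 (conj_part lam) :> nat]
    && [forall c, v ord_max c == ord0].
  apply/forallP/andP => [E | [/forallP E1 /forallP E2] c].
    by split; apply/forallP => c; have /andP[] := E c.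
  by rewrite E1 (eqP (E2 c)).
rewrite (eq_bigl _ _ PE) (eq_bigl _ _ P'E) [RHS]big_mkcondr.
apply: eq_bigr => v Pv.
rewrite (sum_mx_last (x := ord0)); last first.
  by move=> h Qh nz; have [] := last_row _ _ _ Qh nz; rewrite ?PE.
(* If row n of [v] is not empty, the right side is 0, and so is every term on the left by
   [last_row]. *)
case: ifP => [/forallP vmax | /negbT vmax]; last first.
  rewrite big1 // => h Qh; apply/eqP/negPn/negP => nz; case/negP: vmax.
  apply/forallP => c; have [|_ /(_ c)] := last_row _ _ _ Qh nz; first by rewrite PE.
  by rewrite mxE ord_rcons_widen => ->.
apply: eq_big => [h | h _].
  apply/forallP/forallP => E r.
    by have := E (widen_ord (leqnSn n) r); rewrite !mxE !ord_rcons_widen.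
  rewrite !mxE; case: (unliftP ord_max r) => [j|] ->.
    by rewrite lift_max_widen !ord_rcons_widen.
  by rewrite !ord_rcons_max a0.
rewrite big_ord_recr /= [X in _ * X]big1 => [|c _]; last first.
  rewrite !mxE lift0_max !ord_rcons_max ord_rcons_widen (eqP (vmax c)).
  exact: vertexW_empty.
(* The remaining rows keep their index, hence their parameters, since the deleted row is the last
   one. *)
rewrite mulr1; apply: eq_bigr => r _; apply: eq_bigr => c _.
by rewrite !mxE lift0_widen !ord_rcons_widen tnth_rcons_widen.
Qed.

(** The width [L] and the label bound depend on [lam] but not on the number of rows, so only the
    entry a_n of the label vector and the last lattice row have to be removed. *)
Lemma bFs_rcons (lam : seq nat) (n : nat) (kappa : n.-tuple F)
    (rxi rs : nat -> F) :
  sq rs n.+1 * sq rxi n.+1 != 0 ->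
  bFs q lam [::] (rcons_tuple kappa (sq rs n.+1 * sq rxi n.+1)) rxi rs =
  bFs q lam [::] kappa rxi rs.
Proof.
move=> x0; rewrite /bFs (sum_ffun_last (x := ord0)); last first.
  move=> a _; rewrite big_ord_recr /= tnth_rcons_max.
  have -> : (sq rs n.+1 * sq rxi n.+1)^-1 * sq rs n.+1 * sq rxi n.+1 = 1.
    by rewrite -mulrA mulVf.
  (* The third of the five nonzero factors is (1; q)_{a_n}, which forces a_n = 0. *)
  rewrite !mulf_eq0 !negb_or -!andbA => /and5P[_ _ nz _ _].
  by apply: val_inj; rewrite /= (qpoch1_neq0 nz).
apply: eq_big => [b | b _].
  rewrite big_ord_recr /= ffunE ord_rcons_max addn0.
  by under eq_bigr => i _ do rewrite ffunE ord_rcons_widen.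
rewrite ZW_rcons_empty ?ffunE ?ord_rcons_max //; congr (_ * _).
  rewrite big_ord_recr /= ffunE ord_rcons_max !qpoch0 expr0 divr1 !mulr1.
  by apply: eq_bigr => i _; rewrite ffunE ord_rcons_widen tnth_rcons_widen.
by apply: eq_ZW => i; rewrite ffunE ord_rcons_widen.
Qed.

End Stability.

Theorem corollary5p8 (F : fieldType) (q : F) (rxi rs : nat -> F)
    (lam : seq nat) (n : nat) (kappa : n.-1.-tuple F) :
  generic q rxi rs ->
  (forall i : 'I_n.-1, tnth kappa i != 0) ->
  is_partition lam ->
  (2 <= n)%N ->
  bF q lam [::] (rcons_tuple kappa (sq rs n * sq rxi n)) rxi rs
  = bF q lam [::] kappa rxi rs.
Proof.
case: n kappa => // n kappa [_ xi0 s0 _ _] _ _ _.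
rewrite /bF bFs_rcons; last by rewrite mulf_neq0 ?expf_neq0.
(* The number of rows enters the normalization only through the products over mu, which are empty
   here. *)
have negpow0 s : negpow s [::] = 1 :> F by rewrite /negpow big_geq.
have cfac0 s : cfac q s [::] = 1 by rewrite /cfac big_geq.
by rewrite !negpow0 !cfac0.
Qed.
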